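(* For every integer $n\geq 3$, the achromatic index of the Johnson graph $J(n,2)$ satisfies $$ \alpha_2(J(n,2))\geq \begin{cases} n(n-2), & \text{if $n$ is odd},\\ 7, & \text{if $n=4$},\\ n(n-3)+3, & \text{if $n\geq 6$ and $n\equiv 0\pmod{6}$},\\ n(n-3)+2, & \text{if $n\geq 6$, $n$ is even and $n\not\equiv 0\pmod{6}$}. \end{cases} $$
   Context: All graphs are finite, simple and undirected. The Johnson graph $J(n,2)$ has as vertices the $2$-subsets of an $n$-element set, two vertices being adjacent if and only if their intersection has size exactly $1$. Two (distinct) edges of a graph are incident if they share a common vertex. A $t$-edge-coloring of a graph $G$ is a mapping $\varphi:E(G)\to\{1,2,\ldots,t\}$; it induces a partition of $E(G)$ into the color classes $\varphi^{-1}(i)$, $i\in\{1,\ldots,t\}$. It is proper if no two incident edges receive the same color, and complete if for every pair of distinct colors $i,j\in\{1,\ldots,t\}$ there exist two incident edges, one of color $i$ and one of color $j$. The achromatic index $\alpha_2(G)$ is the largest integer $t$ for which $G$ admits a proper and complete $t$-edge-coloring. *)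

(* Defs.v *)
From mathcomp Require Import all_boot.

Set Implicit Arguments.
Unset Strict Implicit.
Unset Printing Implicit Defensive.

Record sgraph := SGraph {
  vertex :> finType;
  adj : rel vertex;
  adj_sym : symmetric adj;
  adj_irrefl : irreflexive adj }.

Definition edges (G : sgraph) : {set {set G}} :=
  [set e | [exists x, exists y, adj x y && (e == [set x; y])]].

Definition edge (G : sgraph) := {e : {set G} | e \in edges G}.

Section EdgeColoring.
Variable G : sgraph.

Definition incident (e f : edge G) : bool :=
  (e != f) && (val e :&: val f != set0).

Definition proper_coloring (t : nat) (phi : {ffun edge G -> 'I_t}) : bool :=
  [forall e, forall f, incident e f ==> (phi e != phi f)].

Definition complete_coloring (t : nat) (phi : {ffun edge G -> 'I_t}) : bool :=
  [forall i, forall j, (i != j) ==>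
    [exists e, exists f, [&& incident e f, phi e == i & phi f == j]]].

Definition proper_complete (t : nat) : bool :=
  [exists phi : {ffun edge G -> 'I_t},
    proper_coloring phi && complete_coloring phi].

(* A complete coloring with at least 2 colors is surjective, hence uses at most
   #|edges G| colors; the extra value t = 1 is needed for edgeless graphs, where
   the empty 1-coloring is vacuously proper and complete.  So the range below
   contains every admissible t. *)
Definition achromatic_index : nat :=
  \max_(t < #|edges G|.+2 | proper_complete t) t.

Lemma proper_complete_bound t : proper_complete t -> t < #|edges G|.+2.
Proof.
case/existsP=> phi /andP[_ /forallP cphi].
case: t phi cphi => [|[|t]] // phi cphi.
rewrite ltnS leqW // -[#|edges G|]card_sig -[t.+2]card_ord.
suff surj i : exists e, phi e == i.
  apply: (@leq_trans #|codom phi|); last exact: leq_image_card.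
  apply/subset_leq_card/subsetP => i _.
  by have [e /eqP <-] := surj i; apply: codom_f.
have [j ij] : exists j, i != j.
  have [-> | i0] := eqVneq i ord0; last by exists ord0.
  by exists ord_max.
have /forallP /(_ j) := cphi i; rewrite ij /=.
by case/existsP=> e /existsP[f /and3P[_ ? _]]; exists e.
Qed.

Lemma achromatic_index_max t : proper_complete t -> t <= achromatic_index.
Proof.
move=> pt; have lt := proper_complete_bound pt.
exact: (@leq_bigmax_cond _ _ (fun i : 'I_ _ => i : nat) (Ordinal lt)).
Qed.

Lemma achromatic_index_attained t :
  proper_complete t -> proper_complete achromatic_index.
Proof.
move=> pt; have lt := proper_complete_bound pt.
rewrite /achromatic_index.
by rewrite (bigmax_eq_arg (Ordinal lt)) //; case: arg_maxnP.
Qed.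

End EdgeColoring.

Section Johnson.
Variable n : nat.

Definition pair2 := {A : {set 'I_n} | #|A| == 2}.

Definition johnson_adj : rel pair2 :=
  fun A B => #|val A :&: val B| == 1.

Lemma johnson_adj_sym : symmetric johnson_adj.
Proof. by move=> A B; rewrite /johnson_adj setIC. Qed.

Lemma johnson_adj_irrefl : irreflexive johnson_adj.
Proof. by move=> A; rewrite /johnson_adj setIid (eqP (valP A)). Qed.

Definition johnson2 : sgraph := SGraph johnson_adj_sym johnson_adj_irrefl.

End Johnson.

(* Main.v *)
Require Import Defs.
From mathcomp Require Import all_boot all_algebra perm zify.

Set Implicit Arguments.
Unset Strict Implicit.
Unset Printing Implicit Defensive.

(** An edge of J(n,2) joins two pairs [{a,u}] and [{a,v}], so it is a path
u - a - v of K_n: a cherry with center a and ends u, v.  Two edges of J(n,2)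
are incident when their cherries share an edge of K_n.

It suffices to exhibit pairwise disjoint matchings of J(n,2), any two of which
contain incident edges: the uncolored edges can then be added greedily, each
receiving a color missing around it or, when it meets all the colors, a new
color ([partial_coloring_extends]).

A matching that covers the whole star of a, that is, all vertices [{a,u}],
touches every matching that covers the star of some b, since both cover
[{a,b}], and every matching that covers some vertex [{a,u}].

- For odd n, the n - 1 elements other than a have a 1-factorization with n - 2
  factors, and each factor yields (n - 1)/2 cherries centered at a that
  cover the star of a.  This gives n(n - 2) matchings
  ([local_factorizations_bound]).

- For even n, n - 3 disjoint 1-factors f_i of the whole vertex set are used.
  The cherries at a along f_i cover the star of a except the vertex
  [{a, f_i a}], which is covered by one more cherry, centered at b = f_i a,
  with ends a and s b a.  The pairs {u, s b u} must avoid all the factors f_i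
  and be distinct for distinct u: they come from an orientation s b of the
  2-regular graph left over by the factors.  The center b spends one pair of
  that graph on each u other than b, s b b and one further vertex, so one
  cherry at b, with ends s b b and s b (s b b), remains.  These n remaining
  cherries are distributed by a map e among a few extra matchings that meet
  all the stars ([star_classes_bound]).

  If 6 divides n, the left-over graph can be chosen as a union of disjoint
  triangles, and e distinguishes the three vertices of a triangle: 3 extra
  matchings.  In general it is the union of two consecutive factors of the
  round-robin tournament, hence a Hamiltonian cycle of even length, and e is
  its proper 2-coloring: 2 extra matchings.

- For n = 4, J(4,2) is the octahedron, where seven matchings are listed. *)

(** * Greedy completion of partial colorings *)

Lemma incident_sym (G : sgraph) (e f : edge G) : incident e f = incident f e.
Proof. by rewrite /incident eq_sym setIC. Qed.

(** The edges with [t <= psi e] are the uncolored ones; the induction is on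
their number.  The number of colors never decreases, although it may grow. *)
Lemma partial_coloring_extends (G : sgraph) (t : nat) (psi : edge G -> nat) :
  (forall e f, incident e f -> psi e = psi f -> t <= psi e) ->
  (forall i j, i < t -> j < t -> i != j ->
     exists e f, [/\ incident e f, psi e = i & psi f = j]) ->
  t <= achromatic_index G.
Proof.
move: {2}_.+1 (ltnSn #|[set e | t <= psi e]|) => m.
elim: m t psi => // m IHm t psi; rewrite ltnS => le_m prop_psi comp_psi.
have [/existsP[e0 e0_free] | /existsPn all_col] := boolP [exists e, t <= psi e];
  last first.
  apply: achromatic_index_max; apply/existsP.
  have lt_psi e : psi e < t by rewrite ltnNge all_col.
  exists [ffun e => Ordinal (lt_psi e)]; apply/andP; split.
    apply/forallP=> e; apply/forallP=> f; apply/implyP=> ef.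
    rewrite !ffunE; apply/eqP=> /(congr1 val) /= /(prop_psi _ _ ef).
    by rewrite leqNgt lt_psi.
  apply/forallP=> i; apply/forallP=> j; apply/implyP=> ij.
  have [e [f [ef ei fj]]] := comp_psi i j (ltn_ord i) (ltn_ord j) ij.
  apply/existsP; exists e; apply/existsP; exists f.
  by rewrite !ffunE ef -!val_eqE /= ei fj !eqxx.
(* Either some color is missing around [e0], which then receives it, or [e0]
   meets every color and may form a new class by itself. *)
have [/existsP[i /forallP i_ok] | /existsPn blocked] :=
  boolP [exists i : 'I_t, forall f, incident e0 f ==> (psi f != i)].
  pose psi' e := if e == e0 then val i else psi e.
  apply: (IHm t psi').
  - apply: leq_trans le_m; apply: proper_card; apply/properP; split.
      apply/subsetP=> e; rewrite !inE /psi'; case: eqP => // _.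
      by rewrite leqNgt ltn_ord.
    by exists e0; rewrite !inE // /psi' eqxx -ltnNge ltn_ord.
  - move=> e f ef; rewrite /psi'.
    have [ee | _] := eqVneq e e0; have [fe | _] := eqVneq f e0.
    + by move: ef; rewrite ee fe /incident eqxx.
    + by rewrite ee in ef => fi; have := i_ok f; rewrite ef -fi eqxx.
    + by rewrite fe incident_sym in ef => ei; have := i_ok e; rewrite ef ei eqxx.
    + exact: prop_psi.
  - move=> k l kt lt kl; have [e [f [ef ek fl]]] := comp_psi k l kt lt kl.
    have colored g : psi g < t -> psi' g = psi g.
      by rewrite /psi'; case: eqP => // ->; rewrite ltnNge e0_free.
    by exists e, f; rewrite !colored ?ek ?fl.
pose psi' e := if e == e0 then t else if t <= psi e then t.+1 else psi e.
have colored g : psi g < t -> psi' g = psi g.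
  rewrite /psi'; case: eqP => [->|_]; first by rewrite ltnNge e0_free.
  by rewrite ltnNge; case: leqP.
apply: leq_trans (IHm t.+1 psi' _ _ _); first exact: leqnSn.
- apply: leq_trans le_m; apply: proper_card; apply/properP; split.
    apply/subsetP=> e; rewrite !inE /psi'; case: eqP => [_|_].
      by rewrite ltnn.
    by case: (leqP t (psi e)) => // lt; rewrite ltnNge ltnW.
  by exists e0; rewrite !inE // /psi' eqxx -ltnNge.
- move=> e f ef; rewrite /psi'.
  have [ee | _] := eqVneq e e0; have [fe | _] := eqVneq f e0.
  + by move: ef; rewrite ee fe /incident eqxx.
  + case: (leqP t (psi f)) => [_ /eqP|lt E]; first by rewrite ltn_eqF.
    by move: lt; rewrite -E ltnn.
  + case: (leqP t (psi e)) => [_ /eqP|lt E]; first by rewrite gtn_eqF.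
    by move: lt; rewrite E ltnn.
  + case: (leqP t (psi e)) => // lt.
    case: (leqP t (psi f)) => [_ E|_ E]; first by move: (ltnW lt); rewrite E ltnn.
    by have := prop_psi _ _ ef E; rewrite leqNgt lt.
have new i : i < t -> exists f, incident e0 f /\ psi' f = i.
  move=> it; have := blocked (Ordinal it); rewrite negb_forall.
  case/existsP=> f; rewrite negb_imply negbK => /andP[ef /eqP fi].
  by exists f; split=> //; rewrite colored fi.
have e0t : psi' e0 = t by rewrite /psi' eqxx.
move=> i j; rewrite !ltnS leq_eqVlt => /predU1P[->|it];
  rewrite leq_eqVlt => /predU1P[->|jt]; first by rewrite eqxx.
- by have [f [ef fj]] := new j jt; exists e0, f.
- by have [f [ef fi]] := new i it; exists f, e0; rewrite incident_sym.
- move=> ij; have [e [f [ef ei fj]]] := comp_psi i j it jt ij.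
  by exists e, f; rewrite !colored ?ei ?fj.
Qed.

Lemma disjoint_classes_le_achromatic_index
    (G : sgraph) (C : finType) (R : C -> pred (edge G)) :
  (forall c d e, R c e -> R d e -> c = d) ->
  (forall c e f, R c e -> R c f -> ~~ incident e f) ->
  (forall c d, c != d -> exists e f, [/\ incident e f, R c e & R d f]) ->
  #|C| <= achromatic_index G.
Proof.
move=> disj matching touch.
pose psi e := if [pick c | R c e] is Some c then enum_rank c : nat else #|C|.
have psiP e (c : C) : R c e -> psi e = enum_rank c.
  rewrite /psi; case: pickP => [d Rd Rc|/(_ c) -> //].
  by rewrite (disj d c e).
apply: (@partial_coloring_extends _ _ psi) => [e f ef|i j it jt ij].
  rewrite /psi; case: pickP => [c Rc|_]; case: pickP => [d Rd|_] // E.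
    move/val_inj/enum_rank_inj: E Rc => -> Rc.
    by have := matching _ _ _ Rc Rd; rewrite ef.
  by rewrite E.
pose c := enum_val (Ordinal it); pose d := enum_val (Ordinal jt).
have cd : c != d by rewrite (inj_eq enum_val_inj).
have [e [f [ef Rc Rd]]] := touch c d cd.
by exists e, f; rewrite (psiP e c) // (psiP f d) // !enum_valK.
Qed.

(** * Cherries *)

Lemma eq_set2l (T : finType) (a u w : T) :
  [set a; u] = [set a; w] -> u = w.
Proof.
move=> E; have := set22 a u; rewrite E => /set2P[ua|//].
by have := set22 a w; rewrite -E ua => /set2P[].
Qed.

Lemma eq_set2 (T : finType) (a u b w : T) :
  [set a; u] = [set b; w] -> (a = b /\ u = w) \/ (a = w /\ u = b).
Proof.
move=> E; have := set21 a u; rewrite E => /set2P[] ab; [left|right]; split=> //.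
  by apply: (@eq_set2l _ a); rewrite E ab.
by apply: (@eq_set2l _ a); rewrite E ab setUC.
Qed.

Section Cherries.
Variables (V : finType) (r : V -> 'I_#|V|).
Hypothesis r_inj : injective r.

Let rpair a u : {set 'I_#|V|} := [set r a; r u].

(** Comparing sets of sets of ordinals, rather than sets of elements of
[pair2], lets cherries be written down without a proof that a and u differ. *)
Definition is_cherry (e : edge (johnson2 #|V|)) (a u v : V) : bool :=
  val @: val e == [set rpair a u; rpair a v].

Lemma cherry_exists a u v :
  a != u -> a != v -> u != v -> exists e, is_cherry e a u v.
Proof.
move=> au av uv.
have c2 x y : x != y -> #|rpair x y| == 2.
  by move=> xy; rewrite cards2 (inj_eq r_inj) xy.
pose p : pair2 _ := Sub (rpair a u) (c2 _ _ au).
pose q : pair2 _ := Sub (rpair a v) (c2 _ _ av).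
have pq : [set p; q] \in edges (johnson2 #|V|).
  rewrite inE; apply/existsP; exists p; apply/existsP; exists q.
  rewrite eqxx andbT /= /johnson_adj /=; apply/eqP.
  rewrite (_ : _ :&: _ = [set r a]) ?cards1 //.
  apply/setP=> x; rewrite !inE; case: eqVneq => //= _.
  apply/negP=> /andP[/eqP-> /eqP/r_inj E].
  by rewrite E eqxx in uv.
exists (exist (fun e => e \in edges (johnson2 #|V|)) _ pq).
by rewrite /is_cherry /= imsetU1 imset_set1.
Qed.

Lemma incident_cherry e f a u v b w x :
  is_cherry e a u v -> is_cherry f b w x -> e != f ->
  incident e f =
    (rpair a u \in [set rpair b w; rpair b x]) ||
    (rpair a v \in [set rpair b w; rpair b x]).
Proof.
move=> /eqP ce /eqP cf ef; rewrite /incident ef /=.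
have -> : (val e :&: val f != set0) = (val @: val e :&: val @: val f != set0).
  rewrite -imsetI; last by move=> ? ? _ _; apply: val_inj.
  by rewrite imset_eq0.
rewrite ce cf; apply/set0Pn/orP => [[x0]|[] h].
- by rewrite !inE; case/andP=> /orP[]/eqP-> ->; [left|right].
- by exists (rpair a u); rewrite inE h set21.
- by exists (rpair a v); rewrite inE h set22.
Qed.
End Cherries.

(** The classes may live on any set V of n points.  [K c a u v] says that the
cherry with center a and ends u, v has color c.  The pair [{a,u}] belongs to
cherries centered at a and to cherries centered at u, whence two hypotheses
for matchings and the disjunction in the last one. *)
Lemma cherry_classes_le_achromatic_index
    (V C : finType) (K : C -> V -> V -> V -> bool) :
  (forall c a u v, K c a u v -> K c a v u) ->
  (forall c a u v, K c a u v -> [/\ a != u, a != v & u != v]) ->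
  (forall c d a u v, K c a u v -> K d a u v -> c = d) ->
  (forall c a u v x, K c a u v -> K c a u x -> v = x) ->
  (forall c a u v x, K c a u v -> K c u a x -> False) ->
  (forall c d, c != d -> exists a u v x,
     K c a u v /\ (K d a u x \/ K d u a x)) ->
  #|C| <= achromatic_index (johnson2 #|V|).
Proof.
move=> Ksym Kneq Kdisj Kmatch Kmatch' Ktouch.
pose r : V -> 'I_#|V| := @enum_rank V.
have r_inj : injective r := @enum_rank_inj V.
pose R c e := [exists a, exists u, exists v, K c a u v && is_cherry r e a u v].
have RP c e : reflect (exists a u v, K c a u v /\ is_cherry r e a u v) (R c e).
  apply: (iffP existsP) => [[a /existsP[u /existsP[v /andP[]]]]|[a [u [v []]]]].
    by exists a, u, v.
  by exists a; apply/existsP; exists u; apply/existsP; exists v; apply/andP.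
have rpair_eq a u b w : [set r a; r u] = [set r b; r w] ->
    (a = b /\ u = w) \/ (a = w /\ u = b).
  by case/eq_set2=> -[/r_inj-> /r_inj->]; [left|right].
(* An edge of the Johnson graph determines its cherry up to the order of the
   two ends. *)
have same_cherry e a u v b w x : u != v -> b != w -> b != x -> w != x ->
    is_cherry r e a u v -> is_cherry r e b w x ->
    a = b /\ ((u = w /\ v = x) \/ (u = x /\ v = w)).
  move=> uv bw bx wx /eqP ce; rewrite /is_cherry ce.
  move=> /eqP/eq_set2[] [/rpair_eq h1 /rpair_eq h2].
    case: h1 => -[? ?]; case: h2 => -[? ?]; subst;
      rewrite ?eqxx // in uv bw bx wx *.
    by split; [|left].
  case: h1 => -[? ?]; case: h2 => -[? ?]; subst;
      rewrite ?eqxx // in uv bw bx wx *.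
  by split; [|right].
have Rdisj c d e : R c e -> R d e -> c = d.
  case/RP=> a [u [v [Kc ce]]] /RP[b [w [x [Kd de]]]].
  have [_ _ uv] := Kneq _ _ _ _ Kc; have [bw bx wx] := Kneq _ _ _ _ Kd.
  have [E] := same_cherry _ _ _ _ _ _ _ uv bw bx wx ce de; subst b.
  case=> -[? ?]; subst w x; first exact: Kdisj Kc Kd.
  exact: Kdisj Kc (Ksym _ _ _ _ Kd).
apply: (@disjoint_classes_le_achromatic_index _ _ R) => // [c e f|c d cd].
  case/RP=> a [u [v [Kc ce]]] /RP[b [w [x [Kd df]]]].
  have [ef | ef] := eqVneq e f; first by rewrite ef /incident eqxx.
  rewrite (incident_cherry ce df ef).
  have clash : forall u v, K c a u v -> is_cherry r e a u v ->
      [set r a; r u] \notin [set [set r b; r w]; [set r b; r x]].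
    move=> {}u {}v {}Kc {}ce.
    have clash : forall w x, K c b w x -> is_cherry r f b w x ->
        [set r a; r u] != [set r b; r w].
      move=> {}w {}x {}Kd {}df; apply/eqP=> /rpair_eq[] [? ?]; subst b w.
        have E := Kmatch _ _ _ _ _ Kc Kd; subst x.
        case/eqP: ef; apply: val_inj; apply: (imset_inj val_inj).
        by rewrite (eqP ce) (eqP df).
      exact: Kmatch' Kc Kd.
    rewrite !inE negb_or (clash w x) //=.
    by apply: (clash x w); [apply: Ksym | rewrite /is_cherry setUC].
  rewrite negb_or (clash u v) //=.
  by apply: (clash v u); [apply: Ksym | rewrite /is_cherry setUC].
have [a [u [v [x [Kc Kd]]]]] := Ktouch c d cd.
have [au av uv] := Kneq _ _ _ _ Kc.
have [e ce] := cherry_exists r_inj au av uv.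
have Rce : R c e by apply/RP; exists a, u, v.
have ne f : R d f -> e != f.
  by move=> Rd; apply: contra_neq cd => E; apply: (Rdisj c d e); rewrite // E.
case: Kd => Kd.
  have [? ax ux] := Kneq _ _ _ _ Kd.
  have [f cf] := cherry_exists r_inj au ax ux.
  have Rdf : R d f by apply/RP; exists a, u, x.
  exists e, f; split=> //.
  by rewrite (incident_cherry ce cf (ne _ Rdf)) !inE eqxx.
have [ua ux ax] := Kneq _ _ _ _ Kd.
have [f cf] := cherry_exists r_inj ua ux ax.
have Rdf : R d f by apply/RP; exists u, a, x.
exists e, f; split=> //.
by rewrite (incident_cherry ce cf (ne _ Rdf)) !inE [[set r u; r a]]setUC eqxx.
Qed.

(** * Matchings covering stars *)

(** The involutions [f a i] fix a and restrict to disjoint 1-factors of the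
other vertices. *)
Lemma local_factorizations_bound
    (V I : finType) (f : V -> I -> V -> V) :
  1 < #|V| ->
  (forall a i u, f a i (f a i u) = u) ->
  (forall a i u, (f a i u == u) = (u == a)) ->
  (forall a i j u, u != a -> f a i u = f a j u -> i = j) ->
  #|V| * #|I| <= achromatic_index (johnson2 #|V|).
Proof.
move=> V2 fK ffix finj; rewrite -card_prod.
have fa a i : f a i a = a by apply/eqP; rewrite ffix.
pose K (c : V * I) x u v := [&& x == c.1, u != x & v == f x c.2 u].
apply: (@cherry_classes_le_achromatic_index _ _ K).
- move=> c a u v /and3P[ac ua /eqP->]; rewrite /K ac fK eqxx andbT /=.
  by apply: contra_neq ua => E; rewrite -(fK a c.2 u) E fa.
- move=> c a u v /and3P[_ ua /eqP->]; split; rewrite eq_sym ?ffix //.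
  by apply: contra_neq ua => E; rewrite -(fK a c.2 u) E fa.
- move=> [c i] [d j] a u v /and3P[/eqP/= <- ua /eqP->] /and3P[/eqP/= <- _ /eqP].
  by move/finj->.
- by move=> c a u v x /and3P[_ _ /eqP->] /and3P[_ _ /eqP->].
- by move=> c a u v x /and3P[/eqP ac ua _] /and3P[/eqP uc _ _];
    rewrite uc ac eqxx in ua.
move=> [c i] [d j] _; have [cd | cd] := eqVneq c d.
  have /existsP[u uc] : [exists u, u != c].
    apply: contraTT V2 => /existsPn h; rewrite -leqNgt.
    have -> : #|V| = #|[set c]|.
      by rewrite -cardsT; congr #|pred_of_set _|; apply/setP=> u;
         have := h u; rewrite !inE negbK => ->.
    by rewrite cards1.
  exists c, u, (f c i u), (f c j u); split; first by rewrite /K /= uc !eqxx.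
  by left; rewrite /K /= -cd uc !eqxx.
exists c, d, (f c i d), (f d j c); rewrite /K /= !eqxx cd eq_sym cd.
by split=> //; right.
Qed.

(** The class (a, i) consists of the cherries at a along [f i] and of the cherry
with center f i a and ends a and s (f i a) a; the class j of J consists of the
cherries with center b and ends in N b, for e b = j.  The condition that
[s b (s b u)] differs from u says that the pairs {u, s b u} are distinct for
distinct u.  The last three hypotheses say that each extra class meets every
star, that two extra classes share a vertex of the Johnson graph, and that
each of them is a matching. *)
Lemma star_classes_bound (V I J : finType) (f : I -> V -> V)
    (s : V -> V -> V) (e : V -> J) :
  let N b := [:: s b b; s b (s b b)] in
  (forall i u, f i (f i u) = u) ->
  (forall i u, f i u != u) ->
  (forall i j u, f i u = f j u -> i = j) ->
  (forall b u, s b u != u) ->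
  (forall b u, s b (s b u) != u) ->
  (forall i b u, s b u != f i u) ->
  (forall j a, exists b, e b = j /\ a \in b :: N b) ->
  (forall j k, j != k ->
     exists b c, [/\ e b = j, e c = k, c \in N b & b \in N c]) ->
  (forall b c, e b = e c -> c \in N b -> b \in N c -> False) ->
  #|V| * #|I| + #|J| <= achromatic_index (johnson2 #|V|).
Proof.
move=> N fK fneq finj sneq ssneq sf hit meet apart.
rewrite -card_prod -card_sum.
(* A cherry with center b along s is identified by the end w with other end
   s b w; [own c b w] says that it has color c. *)
pose own (c : V * I + J) b w := match c with
  | inl (a, i) => (w == a) && (b == f i a)
  | inr j => (w == s b b) && (e b == j)
  end.
pose star (c : V * I + J) x u v := match c with
  | inl (a, i) => [&& x == a, u != a, u != f i a & v == f i u]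
  | inr _ => false
  end.
pose K c x u v :=
  [|| star c x u v, own c x u && (v == s x u) | own c x v && (u == s x v)].
have KP c x u v : K c x u v ->
    [\/ exists i, [/\ c = inl (x, i), u != x, u != f i x & v = f i u],
        own c x u /\ v = s x u | own c x v /\ u = s x v].
  case/or3P=> [|/andP[oc /eqP->]|/andP[oc /eqP->]].
  - case: c => [[a i]|//] /and4P[/eqP-> ? ? /eqP->].
    by apply: Or31; exists i.
  - exact: Or32.
  - exact: Or33.
have own_neq c b w : own c b w -> w != b /\ s b w != b.
  case: c => [[a i]|j] /andP[/eqP-> /eqP] => [->|_]; last by rewrite sneq ssneq.
  by rewrite eq_sym fneq sf.
have own_star x i b w : own (inl (x, i)) b w -> b = f i x.
  by case/andP=> _ /eqP.
have own_disj c d b w : own c b w -> own d b w -> c = d.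
  case: c => [[a i]|j]; case: d => [[a' i']|j']
    /andP[/eqP w1 /eqP b1] /andP[/eqP w2 /eqP b2].
  - by move: b2; rewrite -w2 w1 b1 => /finj->.
  - by have := sneq b b; have := sf i b b; rewrite -w2 w1 [X in f _ X]b1 fK eqxx.
  - by have := sf i' b b; rewrite -w1 w2 [X in f _ X]b2 fK eqxx.
  - by rewrite -b1 b2.
have own_uniq c b w w' : own c b w -> own c b w' -> w = w'.
  by case: c => [[a i]|j] /andP[/eqP-> _] /andP[/eqP-> _].
have Kneq c a u v : K c a u v -> [/\ a != u, a != v & u != v].
  case/KP=> [[i [_ ua uf ->]]|[/own_neq[h1 h2] ->]|[/own_neq[h1 h2] ->]].
  - rewrite eq_sym ua; split=> //; last by rewrite eq_sym fneq.
    by apply: contra_neq uf => ->; rewrite fK.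
  - by rewrite eq_sym h1 eq_sym h2 eq_sym sneq.
  - by rewrite eq_sym h2 eq_sym h1 sneq.
apply: (@cherry_classes_le_achromatic_index _ _ K) => //.
- move=> c a u v /or3P[|h|h].
  + case: c => [[b i]|//] /and4P[/eqP-> ub uf /eqP->].
    rewrite /K /= eqxx fK eqxx andbT.
    have -> : f i u != b by apply: contra_neq uf => <-; rewrite fK.
    by have -> : f i u != f i b by apply: contra_neq ub => /(congr1 (f i)); rewrite !fK.
  + by rewrite /K h !orbT.
  + by rewrite /K h !orbT.
- move=> c d a u v /KP hc /KP hd.
  case: hc => [[i [-> _ _ ->]]|[oc ->]|[oc ->]] in hd *;
    case: hd => [[j [-> _ _ E]]|[od E]|[od E]].
  + by rewrite (finj _ _ _ E).
  + by have := sf i a u; rewrite E eqxx.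
  + by have := sf i a (f i u); rewrite fK -E eqxx.
  + by have := sf j a u; rewrite E eqxx.
  + exact: own_disj oc od.
  + by have := ssneq a u; rewrite -E eqxx.
  + by have := sf j a v; rewrite -[s a v](fK j) -E eqxx.
  + by have := ssneq a v; rewrite -E eqxx.
  + exact: own_disj oc od.
- move=> c a u v x /KP hc /KP hd.
  have nostar i w : own (inl (a, i)) a w -> False.
    by move/own_star => E; have := fneq i a; rewrite -E eqxx.
  case: hc => [[i [ci _ _ ->]]|[oc ->]|[oc uE]];
    case: hd => [[j [cj _ _ ->]]|[od ->]|[od E]].
  + by move: cj; rewrite ci => -[->].
  + by case: (nostar i u); rewrite -ci.
  + by case: (nostar i x); rewrite -ci.
  + by case: (nostar j u); rewrite -cj.
  + by [].
  + by have := sneq a x; rewrite -E (own_uniq _ _ _ _ oc od) eqxx.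
  + by case: (nostar j v); rewrite -cj.
  + by have := sneq a v; rewrite -uE (own_uniq _ _ _ _ oc od) eqxx.
  + exact: own_uniq oc od.
- move=> c a u v x Kc Kd; have [au _ _] := Kneq _ _ _ _ Kc.
  have ownN d b w w' : (own d b w /\ w' = s b w) \/ (own d b w' /\ w = s b w') ->
      match d with inl (y, i) => b = f i y | inr j => e b = j /\ w \in N b end.
    case: d => [[y i]|j] [] [/andP[/eqP h1 /eqP h2] h3] => //; split=> //.
      by rewrite h1 mem_head.
    by rewrite h3 h1 !inE eqxx orbT.
  have KN b w y : K c b w y -> (exists i, c = inl (b, i) /\ w != f i b) \/
      match c with inl (y, i) => b = f i y | inr j => e b = j /\ w \in N b end.
    case/KP=> [[i [-> _ h _]]|h|h]; first by left; exists i.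
      by right; apply: (ownN c b w y); left.
    by right; apply: (ownN c b w y); right.
  case: (KN _ _ _ Kc) => [[i [ci ui]]|hc];
    case: (KN _ _ _ Kd) => [[j [cj uj]]|hd].
  + by move: cj au; rewrite ci => -[-> _]; rewrite eqxx.
  + by move: hd ui; rewrite ci => ->; rewrite eqxx.
  + by move: hc uj; rewrite cj => ->; rewrite eqxx.
  + case: c hc hd {Kc Kd KN} => [[y i] ha hu|j [ea ua] [eu ua']].
      by rewrite ha hu eqxx in au.
    by apply: (apart a u); rewrite ?ea.
pose cov c a u := exists v, K c a u v \/ K c u a v.
have covC c a u : cov c a u -> cov c u a.
  by case=> v [h|h]; exists v; [right|left].
have touch c d a u : cov c a u -> cov d a u ->
    exists a u v x, K c a u v /\ (K d a u x \/ K d u a x).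
  case=> v [h|h] [x h']; first by exists a, u, v, x.
  by exists u, a, v, x; split=> //; case: h'; [right|left].
have cov_star a i w : w != a -> cov (inl (a, i)) a w.
  move=> wa; have [->|wf] := eqVneq w (f i a).
    by exists (s (f i a) a); right; rewrite /K /= !eqxx orbT.
  by exists (f i w); left; rewrite /K /= wa wf !eqxx.
have cov_extra b w : w \in N b -> cov (inr (e b)) b w.
  rewrite !inE => /orP[]/eqP->.
    by exists (s b (s b b)); left; rewrite /K /= !eqxx.
  by exists (s b b); left; rewrite /K /= !eqxx orbT.
have Nneq b w : w \in N b -> w != b.
  by rewrite !inE => /orP[]/eqP->; [apply: sneq | apply: ssneq].
have star_extra a i j : exists x y, cov (inl (a, i)) x y /\ cov (inr j) x y.
  have [b [<-]] := hit j a; rewrite in_cons => /predU1P[->|aN].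
    by exists b, (s b b); split; [apply: cov_star | apply: cov_extra; rewrite mem_head].
  exists b, a; split; last exact: cov_extra.
  by apply: covC; apply: cov_star; rewrite eq_sym Nneq.
move=> [[a i]|j] [[b k]|l] cd.
- have [ab|ab] := eqVneq a b.
    apply: (touch _ _ a (f i a)); first exact: cov_star.
    by rewrite ab; apply: cov_star; rewrite -ab.
  apply: (touch _ _ a b); first by apply: cov_star; rewrite eq_sym.
  by apply: covC; apply: cov_star.
- by have [x [y [h1 h2]]] := star_extra a i l; apply: (touch _ _ x y).
- by have [x [y [h1 h2]]] := star_extra b k j; apply: (touch _ _ x y).
- have jl : j != l by apply: contra_neq cd => ->.
  have [b [c [<- <- cb bc]]] := meet j l jl.
  by apply: (touch _ _ b c); [apply: cov_extra | apply: covC; apply: cov_extra].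
Qed.

(** * The round-robin 1-factorization *)

Section RoundRobin.
Import GRing.Theory.
Local Open Scope ring_scope.
Variable A : zmodType.
Hypothesis double_inj : injective (fun x : A => x + x).

(** In round i of the tournament on A and a point at infinity, [None], x meets
the player y with x + y = 2i, and i meets infinity. *)
Definition round_robin (i : A) (u : option A) : option A :=
  if u is Some x then if x == i then None else Some (i + i - x) else Some i.

Lemma round_robinK i : involutive (round_robin i).
Proof.
case=> [x|] /=; last by rewrite eqxx.
have [->|xi] //= := eqVneq x i; have [E|_] := eqVneq (i + i - x) i.
  by case/eqP: xi; rewrite -[x](subKr (i + i)) E addrK.
by rewrite subKr.
Qed.

Lemma round_robin_neq i u : round_robin i u != u.
Proof.
case: u => [x|] //=; have [//|xi] := eqVneq x i; apply/eqP=> -[E].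
by case/eqP: xi; apply/esym/double_inj/eqP; rewrite -subr_eq E.
Qed.

Lemma round_robin_inj i j u : round_robin i u = round_robin j u -> i = j.
Proof.
case: u => [x|] /=; last by case.
have [<-|xi] := eqVneq x i; have [<-|xj] //= := eqVneq x j.
by case=> /addIr; apply: double_inj.
Qed.
End RoundRobin.

Lemma modn_lt_double k d : k < d + d -> k %% d = if k < d then k else k - d.
Proof.
move=> kd; case: ltnP => [/modn_small // | dk].
by rewrite -[in LHS](subnK dk) modnDr modn_small //; lia.
Qed.

Lemma odd_double_inj m : ~~ odd m -> injective (fun x : 'I_m.+1 => (x + x)%R).
Proof.
move=> m_even x y /(congr1 val) /=.
have ? := ltn_ord x; have ? := ltn_ord y.
rewrite !modn_lt_double; [|lia..] => E; apply: val_inj => /=.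
by move: E; case: (ltnP (x + x)) => ?; case: (ltnP (y + y)) => ?; lia.
Qed.

(** * Odd n *)

(** The round-robin factors of the points other than [None] are moved to those
other than a by the transposition of [None] and a. *)
Lemma odd_bound m : ~~ odd m ->
  m.+3 * m.+1 <= achromatic_index (johnson2 m.+3).
Proof.
move=> /odd_double_inj dbl.
pose W := option 'I_m.+1.
have cV : #|{: option W}| = m.+3 by rewrite !card_option card_ord.
pose g i (u : option W) := omap (round_robin i) u.
have gK i : involutive (g i) by case=> //= w; rewrite round_robinK.
have gfix i u : (g i u == u) = (u == None).
  by case: u => //= w; apply/negbTE; rewrite (inj_eq Some_inj) round_robin_neq.
pose f a i u := tperm None a (g i (tperm None a u)).
rewrite -{2}(card_ord m.+1) -cV.
apply: (@local_factorizations_bound _ _ f) => [|a i u|a i u|a i j u ua].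
- by rewrite cV.
- by rewrite /f !tpermK gK tpermK.
- rewrite /f -[X in _ == X](tpermK None a u) (inj_eq perm_inj) gfix.
  by rewrite (can2_eq (tpermK None a) (tpermK None a)) tpermL.
- move/perm_inj; have : tperm None a u != None.
    by rewrite (can2_eq (tpermK None a) (tpermK None a)) tpermL.
  by case: (tperm None a u) => // w _ [/(round_robin_inj dbl)].
Qed.

(** * Multiples of 6 *)

(** On the vertex set Z/3 x W, the factor (j, d) sends (x, w) to (d - x, g_j w)
with g_j a round-robin factor of W, so that the left-over graph consists of
the triangles with constant w, oriented cyclically.  The three extra classes
are indexed by the first coordinate of the center. *)
Lemma divisible_by_6_bound m n : ~~ odd m -> n = 3 * m.+2 ->
  n * (n - 3) + 3 <= achromatic_index (johnson2 n).
Proof.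
move=> m_even nE; have dbl := odd_double_inj m_even.
pose V := ('I_3 * option 'I_m.+1)%type.
have cV : #|{: V}| = n by rewrite nE card_prod card_option !card_ord.
pose f (i : 'I_m.+1 * 'I_3) (u : V) : V := ((i.2 - u.1)%R, round_robin i.1 u.2).
pose s (_ u : V) : V := ((u.1 + 1)%R, u.2).
have := @star_classes_bound V _ 'I_3 f s fst.
rewrite cV card_prod !card_ord (_ : n - 3 = m.+1 * 3); last lia.
apply=> [i [x w]|i u|[j d] [k d'] [x w]|b [x w]|b [x w]|i b u|j [x w]|j k jk|].
- by rewrite /f /= GRing.subKr round_robinK.
- by rewrite -pair_eqE /= (negbTE (round_robin_neq _ _ _)) ?andbF.
- move=> E; have /= /(round_robin_inj dbl) -> := congr1 snd E.
  by have /= /GRing.addIr -> := congr1 fst E.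
- by rewrite /s -pair_eqE /=; case: x => -[|[|[|]]].
- by rewrite /s -pair_eqE /=; case: x => -[|[|[|]]].
- by rewrite /s /f -pair_eqE /= eq_sym [w in _ && w]eq_sym
    (negbTE (round_robin_neq _ _ _)) ?andbF.
- exists (j, w); split=> //; rewrite !inE -!pair_eqE /= eqxx !andbT.
  by case: x j => -[|[|[|]]] // ? [[|[|[|]]]].
- exists (j, None), (k, None); rewrite !inE -!pair_eqE /= !andbT; split=> //;
  by case: j k jk => -[|[|[|]]] // ? [[|[|[|]]]].
- move=> [x w] [y w'] /= <-; rewrite !inE -!pair_eqE /=.
  by case: x => -[|[|[|]]].
Qed.

(** * Even n *)

Lemma val_sub m (x y : 'I_m.+1) :
  nat_of_ord (x - y)%R = if y <= x then x - y else m.+1 + x - y.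
Proof.
have ? := ltn_ord x; have ? := ltn_ord y.
rewrite /= (@modn_lt_double (m.+1 - y)); last lia.
case: (ltnP (m.+1 - y) m.+1) => ?; rewrite modn_lt_double; try lia;
  by case: ltnP => ?; case: leqP => ?; lia.
Qed.

(** The numeral m.+1 encodes the point at infinity. *)
Definition position m (u : option 'I_m.+1) : nat :=
  if u is Some x then val x else m.+1.

(** The union of the rounds 0 and 1 is the cycle infinity, 0, 2, -2, 4, -4 and
so on up to 1, as the two rounds are negation and reflection about 1.  The
number of residues being odd, the representative of -2k is odd, so the proper
2-coloring of the cycle is given by parity, with exceptions at infinity and
0. *)
Definition round_robin_side m (u : option 'I_m.+1) : bool :=
  (position u == m.+1) || (0 < position u) && ~~ odd (position u).

Lemma position_round_robin m (i : 'I_m.+1) u : 1 < m -> i <= 1 ->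
  let p := position u in
  position (round_robin i u) =
    if p == m.+1 then val i else if p == i then m.+1
    else if p <= i + i then i + i - p else m.+1 + (i + i) - p.
Proof.
move=> m1 i1; case: u => [x|]; last by rewrite /= eqxx.
rewrite /position /round_robin ltn_eqF ?ltn_ord //.
case: (x =P i) => [->|xi]; first by rewrite eqxx.
have /negbTE-> : val x != val i by apply/eqP=> /val_inj.
have ii : nat_of_ord (i + i)%R = i + i by rewrite /= modn_small //; lia.
by have := val_sub (i + i)%R x; rewrite ii.
Qed.

Lemma position_le m (u : option 'I_m.+1) : position u <= m.+1.
Proof. by case: u => //= x; rewrite ltnW. Qed.

Lemma round_robin_side_flip m (i : 'I_m.+1) u : ~~ odd m -> 1 < m -> i <= 1 ->
  round_robin_side (round_robin i u) = ~~ round_robin_side u.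
Proof.
move=> m_even m1 i1; have := position_le u; rewrite /round_robin_side.
rewrite position_round_robin //=; move: (position u) (nat_of_ord i) i1 => p k k1.
by case: (p =P m.+1) => ?; case: (p =P k) => ?; case: (leqP p (k + k)) => ?; lia.
Qed.

Lemma position_two_steps m (i j : 'I_m.+1) u :
  2 < m -> i = 0 :> nat -> j = 1 :> nat ->
  let p := position u in
  position (round_robin j (round_robin i u)) =
    if p == m.+1 then 2 else if p == 0 then 1
    else if p == m then m.+1 else if p.+1 == m then 0 else p.+2.
Proof.
move=> m2 i0 j1; rewrite !position_round_robin; [|lia..].
rewrite /= i0 j1; have := position_le u; move: (position u) => p pm.
case: (p =P m.+1) => ?; first by [].
case: (p =P 0) => ?; first by rewrite eqxx.
have -> /= : p <= 0 + 0 = false by lia.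
have -> : (m.+1 + (0 + 0) - p == m.+1) = false by lia.
case: (p =P m) => ?; first by have -> : m.+1 + (0 + 0) - p = 1 by lia.
have -> : (m.+1 + (0 + 0) - p == 1) = false by lia.
by case: leqP => ?; case: (p.+1 =P m) => ?; lia.
Qed.

(** A step of round 0 followed by one of round 1 sends x to x + 2, except that
it sends -1 to infinity, infinity to 2 and 0 to 1.  Applied twice it fixes no
point as soon as there are four residues. *)
Lemma round_robin_cycle m (i j : 'I_m.+1) u :
  2 < m -> i = 0 :> nat -> j = 1 :> nat ->
  round_robin j (round_robin i (round_robin j (round_robin i u))) <> u.
Proof.
move=> m2 i0 j1 /(congr1 (@position m)).
rewrite !(position_two_steps _ m2 i0 j1) /=.
have := position_le u; move: (position u) => p pm.
case: (p =P m.+1) => ?; first by do !case: eqP; lia.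
case: (p =P 0) => ?; first by do !case: eqP; lia.
case: (p =P m) => ?; first by rewrite eqxx; lia.
case: (p.+1 =P m) => ?; first by rewrite /=; lia.
by do !case: eqP; lia.
Qed.

(** The successor s b u along the Hamiltonian cycle formed by rounds 0 and 1, run
from b in the direction of round 0, is the neighbor of u in round 0 when u
is on the side of b, and in round 1 otherwise.  The extra classes collect the
centers of either side.  They share the vertices {b, c} of round 0, and they
are matchings because two steps along the cycle, done twice, do not return to
the start. *)
Lemma even_bound m : ~~ odd m -> 3 < m ->
  m.+2 * (m.+2 - 3) + 2 <= achromatic_index (johnson2 m.+2).
Proof.
move=> m_even m3; have dbl := odd_double_inj m_even.
pose V := option 'I_m.+1.
have cV : #|{: V}| = m.+2 by rewrite card_option card_ord.
pose i0 : 'I_m.+1 := ord0; have m1 : 1 < m.+1 by lia.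
pose i1 : 'I_m.+1 := Ordinal m1.
pose I := {i : 'I_m.+1 | i \notin [:: i0; i1]}.
have cI : #|{: I}| = m.+2 - 3.
  rewrite card_sig; have := cardC (mem [:: i0; i1]).
  rewrite [X in _ = X]card_ord (card_uniqP _) //= => E.
  rewrite (_ : m.+2 - 3 = m.+1 - 2); last lia.
  by apply/eqP; rewrite -(eqn_add2l 2) subnKC ?E; [apply/eqP | lia].
pose side := @round_robin_side m.
have flip (i : 'I_m.+1) (u : V) : i <= 1 -> side (round_robin i u) = ~~ side u.
  by move=> ?; rewrite /side round_robin_side_flip //; lia.
pose s (b u : V) : V := round_robin (if side u == side b then i0 else i1) u.
have s_flip b u : side (s b u) = ~~ side u by rewrite flip //; case: ifP.
have := @star_classes_bound V I bool (fun i => round_robin (val i)) s side.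
rewrite cV cI card_bool; apply=> [i u|i u|i j u|b u|b u|i b u|j a|j k jk|b c bc].
- exact: round_robinK.
- exact: round_robin_neq.
- by move/(round_robin_inj dbl)/val_inj.
- exact: round_robin_neq.
- apply/eqP=> E; have := round_robinK (if side u == side b then i0 else i1) u.
  rewrite -/(s b u) -[X in _ = X]E => /(round_robin_inj dbl).
  by rewrite s_flip; case: (side u); case: (side b).
- apply/eqP=> /(round_robin_inj dbl) E; have /negP[] := valP i.
  by rewrite -E; case: ifP; rewrite !inE eqxx ?orbT.
- have s_self b : s b b = round_robin i0 b by rewrite /s eqxx.
  have [aj|aj] := eqVneq (side a) j; first by exists a; rewrite mem_head.
  exists (round_robin i0 a); rewrite flip //; split.
    by case: j (side a) aj => [] [].
  by rewrite !inE s_self round_robinK eqxx orbT.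
- have s_self b : s b b = round_robin i0 b by rewrite /s eqxx.
  exists (if side None == j then None else round_robin i0 None),
    (if side None == j then round_robin i0 None else None).
  have side_None : side (round_robin i0 None) = ~~ side None by rewrite flip.
  case: ifP => jN; rewrite !inE !s_self ?round_robinK !eqxx ?orTb; split=> //;
    by case: j k (side None) jk jN side_None => [] [] [].
have s_self d : s d d = round_robin i0 d by rewrite /s eqxx.
have s_self2 d : s d (s d d) = round_robin i1 (round_robin i0 d).
  by rewrite {1}/s s_flip s_self; case: (side d).
rewrite !inE => /orP[/eqP cE|/eqP cE].
  by move: bc; rewrite cE s_flip; case: (side b).
case/orP=> /eqP bE; first by move: bc; rewrite bE s_flip; case: (side c).
have := @round_robin_cycle m i0 i1 b; apply=> //; first by lia.
by rewrite -(s_self2 b) -cE -s_self2 -bE.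
Qed.

(** * The octahedron *)

Lemma all_iotaP n (P : pred nat) : all P (iota 0 n) -> forall i : 'I_n, P i.
Proof. by move=> /allP h i; apply: h; rewrite mem_iota /=. Qed.

Lemma has_iotaP n (P : pred nat) : has P (iota 0 n) -> exists i : 'I_n, P i.
Proof. by case/hasP=> k; rewrite mem_iota /= => kn Pk; exists (Ordinal kn). Qed.

(** Two matchings with two edges cover four of the six vertices each, so they
always share a vertex.  The two singletons are incident, and the ten remaining
edges are grouped so that each pair touches both of them. *)
Definition octahedron_classes : seq (seq (nat * nat * nat)) :=
  [:: [:: (0, 1, 2)]; [:: (0, 1, 3)];
      [:: (0, 2, 3); (1, 2, 3)]; [:: (1, 0, 2); (3, 1, 2)];
      [:: (1, 0, 3); (2, 1, 3)]; [:: (2, 0, 1); (3, 0, 2)];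
      [:: (2, 0, 3); (3, 0, 1)]].

Definition octahedron_class c a u v : bool :=
  let s := nth [::] octahedron_classes c in
  ((a, u, v) \in s) || ((a, v, u) \in s).

Lemma octahedron_bound : 7 <= achromatic_index (johnson2 4).
Proof.
pose K (c : 'I_7) (a u v : 'I_4) := octahedron_class c a u v.
have := @cherry_classes_le_achromatic_index 'I_4 'I_7 K.
rewrite !card_ord; apply.
- by move=> c a u v; rewrite /K /octahedron_class orbC.
- move=> c a u v Kc; pose P c a u v :=
    octahedron_class c a u v ==> [&& a != u, a != v & u != v].
  have T : all (fun c => all (fun a => all (fun u => all (P c a u)
    (iota 0 4)) (iota 0 4)) (iota 0 4)) (iota 0 7) by vm_compute.
  have /implyP/(_ Kc)/and3P :=
    all_iotaP (all_iotaP (all_iotaP (all_iotaP T c) a) u) v.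
  by [].
- move=> c d a u v Kc Kd; pose P c d a u v :=
    octahedron_class c a u v ==> octahedron_class d a u v ==> (c == d).
  have T : all (fun c => all (fun d => all (fun a => all (fun u => all (P c d a u)
    (iota 0 4)) (iota 0 4)) (iota 0 4)) (iota 0 7)) (iota 0 7) by vm_compute.
  have := all_iotaP (all_iotaP (all_iotaP (all_iotaP (all_iotaP T c) d) a) u) v.
  by move=> /implyP/(_ Kc)/implyP/(_ Kd)/eqP/val_inj.
- move=> c a u v x Kc Kd; pose P c a u v x :=
    octahedron_class c a u v ==> octahedron_class c a u x ==> (v == x).
  have T : all (fun c => all (fun a => all (fun u => all (fun v => all (P c a u v)
    (iota 0 4)) (iota 0 4)) (iota 0 4)) (iota 0 4)) (iota 0 7) by vm_compute.
  have := all_iotaP (all_iotaP (all_iotaP (all_iotaP (all_iotaP T c) a) u) v) x.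
  by move=> /implyP/(_ Kc)/implyP/(_ Kd)/eqP/val_inj.
- move=> c a u v x Kc Kd; pose P c a u v x :=
    octahedron_class c a u v ==> ~~ octahedron_class c u a x.
  have T : all (fun c => all (fun a => all (fun u => all (fun v => all (P c a u v)
    (iota 0 4)) (iota 0 4)) (iota 0 4)) (iota 0 4)) (iota 0 7) by vm_compute.
  have := all_iotaP (all_iotaP (all_iotaP (all_iotaP (all_iotaP T c) a) u) v) x.
  by move=> /implyP/(_ Kc)/negP.
move=> c d cd; pose Q c d a u v x := octahedron_class c a u v &&
  (octahedron_class d a u x || octahedron_class d u a x).
pose P c d := (c != d) ==> has (fun a => has (fun u => has (fun v =>
  has (Q c d a u v) (iota 0 4)) (iota 0 4)) (iota 0 4)) (iota 0 4).
have T : all (fun c => all (P c) (iota 0 7)) (iota 0 7) by vm_compute.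
have /implyP/(_ cd) := all_iotaP (all_iotaP T c) d.
case/has_iotaP=> a /has_iotaP[u /has_iotaP[v /has_iotaP[x /andP[Kc /orP Kd]]]].
by exists a, u, v, x.
Qed.

(** * The four cases *)

Theorem theorem2p1 (n : nat) (hn : 3 <= n) :
  [/\ odd n -> n * (n - 2) <= achromatic_index (johnson2 n),
      n = 4 -> 7 <= achromatic_index (johnson2 n),
      6 <= n -> n = 0 %[mod 6] ->
        n * (n - 3) + 3 <= achromatic_index (johnson2 n)
    & 6 <= n -> ~~ odd n -> n <> 0 %[mod 6] ->
        n * (n - 3) + 2 <= achromatic_index (johnson2 n)].
Proof.
split.
- case: n hn => [|[|[|m]]] // _ n_odd.
  by rewrite !subSS subn0; apply: odd_bound; lia.
- by move=> ->; apply: octahedron_bound.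
- move=> n6 nmod; have dvd6 : n = n %/ 6 * 6 by lia.
  by apply: (@divisible_by_6_bound (n %/ 6 * 2 - 2)); lia.
- case: n hn => [|[|m]] // _ m4 m_even _.
  by apply: even_bound; lia.
Qed.
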